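(* Let $k$ be a commutative Noetherian ring and let $A$ be an affine cellular $k$-algebra with cell chain $0=J_{-1}\subset J_0\subset\cdots\subset J_n=A$ and cell data $B_j$, $n_j$, $\psi_j$ ($0\le j\le n$), such that $B_j$ is reduced and $\det(\psi_j)$ is not a zero divisor in $B_j$ for all $j$. Let $m=\min\{l\mid\mathrm{r.ann}_{A/J_{l-1}}(J_l/J_{l-1})=0\}$ and let $$\Phi:A\to M_{n_0}(B_0)\times\cdots\times M_{n_m}(B_m)$$ be the embedding given by right multiplication of $A$ on the quotients $J_j/J_{j-1}$, $0\le j\le m$. Then $A$ is Noetherian and finitely generated as a module over its centre $c(A)$ if and only if $c(A)=\Phi^{-1}(B_0\times\cdots\times B_m)$ is a Noetherian ring.
   Context: Noetherian means left and right Noetherian. $\mathrm{r.ann}_R(X)=\{a\in R\mid xa=0\ \forall x\in X\}$. For a commutative ring $B$ and $\psi\in M_r(B)$, $(M_r(B),\psi)$ denotes the additive group of $M_r(B)$ with multiplication $a*b=a\psi b$. Affine cell ideals: let $A$ be a unital $k$-algebra with a $k$-involution $i$ ($k$-linear anti-automorphism with $i^2=\mathrm{id}$). A two-sided ideal $J$ is an affine cell ideal if: (1) $i(J)=J$; (2) there are a free $k$-module $V$ of finite rank $r\ge1$ and an affine (finitely generated) commutative unital $k$-algebra $B$ with a $k$-involution $\sigma$ such that $\Delta:=V\otimes_kB$ is an $A$-$B$-bimodule, with right $B$-structure induced by $B_B$; (3) there is an $A$-$A$-bimodule isomorphism $\alpha:J\to\Delta\otimes_B\Delta'$, where $\Delta'=B\otimes_kV$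 is the $B$-$A$-bimodule with left $B$-structure induced by ${}_BB$ and right $A$-structure $(b\otimes v)a:=\tau(i(a)(v\otimes b))$, $\tau:\Delta\to\Delta'$ being the flip, such that $\alpha\circ i=\theta\circ\alpha$ with $\theta(v_1\otimes b_1\otimes_Bb_2\otimes v_2)=v_2\otimes\sigma(b_2)\otimes_B\sigma(b_1)\otimes v_1$. Identify $\Delta\otimes_B\Delta'$ with $V\otimes_kB\otimes_kV$ and fix a basis $v_1,\dots,v_r$ of $V$. Then there is a matrix $\psi=(\psi_{st})\in M_r(B)$ such that the multiplication of $J$, transported via $\alpha$, is $(v_i\otimes b\otimes v_j)(v_s\otimes c\otimes v_t)=v_i\otimes b\psi_{js}c\otimes v_t$, so that $J\simeq(M_r(B),\psi)$ as rings via $v_i\otimes b\otimes v_j\mapsto bE_{ij}$. The cell data of $J$ are $B$, $r$, $\psi$. Affine cellular algebras: a unital $k$-algebra $A$ with $k$-involution $i$ is affine cellular if there is a $k$-module decomposition $A=J_0'\oplus\cdots\oplus J_n'$ with $i(J_j')=J_j'$ such that $J_j=\bigoplus_{l\le j}J_l'$ gives a chain of two-sided ideals $0=J_{-1}\subset J_0\subset\cdots\subset J_n=A$ (a cell chain) and each $J_j/J_{j-1}$ is an affine cell ideal of $A/J_{j-1}$ with respect to the induced involution; $B_j,n_j,\psi_j$ are the cell data of $J_j/J_{j-1}$. The embedding $\Phi$: under the stated hypotheses, for $0\le j\le m$ every left $A/J_{j-1}$-linear endomorphism of $J_j/J_{j-1}\simeq(M_{n_j}(B_j),\psi_j)$ is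 right matrix multiplication by a unique matrix in $M_{n_j}(B_j)$; the $j$-th component of $\Phi(a)$ is the matrix corresponding to right multiplication by $a+J_{j-1}$ on $J_j/J_{j-1}$. The map $\Phi$ is an injective ring homomorphism. $B_j$ is identified with the scalar matrices in $M_{n_j}(B_j)$. *)

(* Defs.v *)
From HB Require Import structures.
From mathcomp Require Import all_boot all_order all_algebra.
From mathcomp Require Import boolp classical_sets functions.

Set Implicit Arguments.
Unset Strict Implicit.
Unset Printing Implicit Defensive.

Import GRing.Theory.

Local Open Scope ring_scope.
Local Open Scope quotient_scope.
Local Open Scope classical_set_scope.

Section RingNotions.
Variable R : pzRingType.
Implicit Types I X : set R.

Definition left_ideal I : Prop :=
  [/\ I 0, forall x y, I x -> I y -> I (x + y) & forall a x, I x -> I (a * x)].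

Definition right_ideal I : Prop :=
  [/\ I 0, forall x y, I x -> I y -> I (x + y) & forall a x, I x -> I (x * a)].

Definition left_noetherian : Prop :=
  forall I, left_ideal I -> exists (n : nat) (g : 'I_n -> R),
    I = [set x | exists c : 'I_n -> R, x = \sum_(t < n) c t * g t].

Definition right_noetherian : Prop :=
  forall I, right_ideal I -> exists (n : nat) (g : 'I_n -> R),
    I = [set x | exists c : 'I_n -> R, x = \sum_(t < n) g t * c t].

Definition noetherian : Prop := left_noetherian /\ right_noetherian.

Definition right_ann X : set R := [set a | forall x, X x -> x * a = 0].

Definition reduced : Prop := forall (b : R) (e : nat), b ^+ e = 0 -> b = 0.

End RingNotions.

Section Center.
Variable A : nzRingType.

Definition center : {pred A} := [pred a | `[< forall b, a * b = b * a >]].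

Lemma centerP a : reflect (forall b, a * b = b * a) (a \in center).
Proof. exact: asboolP. Qed.

Fact center_subring_closed : subring_closed center.
Proof.
split=> [|x y /centerP cx /centerP cy|x y /centerP cx /centerP cy].
- by apply/centerP => b; rewrite mul1r mulr1.
- by apply/centerP => b; rewrite mulrBl mulrBr cx cy.
- by apply/centerP => b; rewrite -mulrA cy mulrA cx mulrA.
Qed.

HB.instance Definition _ :=
  GRing.isSubringClosed.Build A center center_subring_closed.

Record center_ring := CenterRing { center_val : A; _ : center_val \in center }.

HB.instance Definition _ := [isSub for center_val].
HB.instance Definition _ := [Choice of center_ring by <:].
HB.instance Definition _ := [SubChoice_isSubNzRing of center_ring by <:].

Fact center_mulC : commutative (@GRing.mul center_ring).
Proof.
move=> x y; apply: val_inj; rewrite !rmorphM /=.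
exact: (centerP _ (valP x)).
Qed.

HB.instance Definition _ :=
  GRing.PzRing_hasCommutativeMul.Build center_ring center_mulC.

Definition finite_over_center : Prop :=
  exists (N : nat) (g : 'I_N -> A), forall a, exists c : 'I_N -> center_ring,
    a = \sum_(t < N) val (c t) * g t.

End Center.

Arguments center A _ : clear implicits.

HB.mixin Record isProperTwoSided (A : nzRingType) (I : A -> bool) := {
  two_sided_subproof :
    [/\ ~~ I 1, forall a x, I x -> I (a * x) & forall a x, I x -> I (x * a)]
}.

#[short(type="idealType")]
HB.structure Definition TwoSidedIdeal (A : nzRingType) :=
  {I of GRing.ZmodClosed A I & isProperTwoSided A I}.

Definition alg_quot (k : comNzRingType) (A : algType k) (I : idealType A) :
  Type := Quotient.quot I.

Section AlgebraQuotient.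
Variables (k : comNzRingType) (A : algType k) (I : idealType A).

Local Notation Q := (alg_quot I).

HB.instance Definition _ := ZmodQuotient.on Q.

Fact two_sided_properF : (1 \in (I : {pred A})) = false.
Proof. by case: (@two_sided_subproof _ I) => /negPf. Qed.

Fact two_sidedMl a x : x \in (I : {pred A}) -> a * x \in (I : {pred A}).
Proof. by case: (@two_sided_subproof _ I) => _ h _; exact: h. Qed.

Fact two_sidedMr a x : x \in (I : {pred A}) -> x * a \in (I : {pred A}).
Proof. by case: (@two_sided_subproof _ I) => _ _ h; exact: h. Qed.

Lemma alg_quotE (x y : A) :
  (\pi_Q x = \pi_Q y) <-> x - y \in (I : {pred A}).
Proof.
by rewrite Quotient.idealrBE; split=> [-> //|/eqP].
Qed.

Fact repr_piB (x : A) : repr (\pi_Q x) - x \in (I : {pred A}).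
Proof. by apply/alg_quotE; rewrite reprK. Qed.

Definition quot_one : Q := \pi_Q 1.
Definition quot_mul (x y : Q) : Q := \pi_Q (repr x * repr y).
Definition quot_scale (c : k) (x : Q) : Q := \pi_Q (c *: repr x).

Fact quot_piM x y : \pi_Q (x * y) = quot_mul (\pi x) (\pi y).
Proof.
apply/esym/alg_quotE.
have -> : repr (\pi_Q x) * repr (\pi_Q y) - x * y =
    (repr (\pi_Q x) - x) * repr (\pi_Q y) + x * (repr (\pi_Q y) - y).
  by rewrite mulrBl mulrBr addrA subrK.
by apply: rpredD; [apply: two_sidedMr|apply: two_sidedMl]; exact: repr_piB.
Qed.

Fact quot_piZ c x : \pi_Q (c *: x) = quot_scale c (\pi x).
Proof.
apply/esym/alg_quotE; rewrite -scalerBr -mulr_algl.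
by apply: two_sidedMl; exact: repr_piB.
Qed.

Fact quot_piD x y : \pi_Q (x + y) = \pi_Q x + \pi_Q y.
Proof. exact: (@pi_addr _ _ _ _ _ (Quotient.quot I)). Qed.

Fact quot_mulA : associative quot_mul.
Proof.
elim/quotW=> a; elim/quotW=> b; elim/quotW=> c.
by rewrite -(quot_piM b c) -(quot_piM a) -(quot_piM a b) -(quot_piM _ c) mulrA.
Qed.

Fact quot_mul1r : left_id quot_one quot_mul.
Proof. by elim/quotW=> a; rewrite -(quot_piM 1 a) mul1r. Qed.

Fact quot_mulr1 : right_id quot_one quot_mul.
Proof. by elim/quotW=> a; rewrite -(quot_piM a 1) mulr1. Qed.

Fact quot_mulDl : left_distributive quot_mul +%R.
Proof.
elim/quotW=> a; elim/quotW=> b; elim/quotW=> c.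
by rewrite -(quot_piD a b) -!(quot_piM _ c) mulrDl quot_piD.
Qed.

Fact quot_mulDr : right_distributive quot_mul +%R.
Proof.
elim/quotW=> a; elim/quotW=> b; elim/quotW=> c.
by rewrite -(quot_piD b c) -!(quot_piM a) mulrDr quot_piD.
Qed.

Fact quot_one_neq0 : quot_one != 0.
Proof.
apply/eqP => h; have /alg_quotE : \pi_Q (1 : A) = \pi_Q 0.
  by rewrite [LHS]h; exact/esym/(@pi_zeror _ _ _ _ _ (Quotient.quot I)).
by rewrite subr0 two_sided_properF.
Qed.

HB.instance Definition _ := GRing.Zmodule_isNzRing.Build Q
  quot_mulA quot_mul1r quot_mulr1 quot_mulDl quot_mulDr quot_one_neq0.

Fact quot_scaleA a b x : quot_scale a (quot_scale b x) = quot_scale (a * b) x.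
Proof. by elim/quotW: x => x; rewrite -(quot_piZ b x) -!quot_piZ scalerA. Qed.

Fact quot_scale1 : left_id 1 quot_scale.
Proof. by elim/quotW=> x; rewrite -(quot_piZ 1 x) scale1r. Qed.

Fact quot_scaleDr : right_distributive quot_scale +%R.
Proof.
move=> c; elim/quotW=> x; elim/quotW=> y.
by rewrite -(quot_piD x y) -!(quot_piZ c) scalerDr quot_piD.
Qed.

Fact quot_scaleDl x : {morph quot_scale^~ x : a b / a + b}.
Proof.
by move=> a b; elim/quotW: x => x; rewrite -!(quot_piZ _ x) scalerDl quot_piD.
Qed.

HB.instance Definition _ := GRing.Zmodule_isLmodule.Build k Q
  quot_scaleA quot_scale1 quot_scaleDr quot_scaleDl.

Fact quot_scaleAl (c : k) (x y : Q) : c *: (x * y) = (c *: x) * y.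
Proof.
elim/quotW: x => x; elim/quotW: y => y.
have -> : \pi_Q x * \pi_Q y = \pi_Q (x * y) by rewrite quot_piM.
have -> : c *: \pi_Q (x * y) = \pi_Q (c *: (x * y)) by rewrite quot_piZ.
by rewrite scalerAl quot_piM quot_piZ.
Qed.

HB.instance Definition _ := GRing.Lmodule_isLalgebra.Build k Q quot_scaleAl.

Fact quot_scaleAr (c : k) (x y : Q) : c *: (x * y) = x * (c *: y).
Proof.
elim/quotW: x => x; elim/quotW: y => y.
have -> : \pi_Q x * \pi_Q y = \pi_Q (x * y) by rewrite quot_piM.
have -> : c *: \pi_Q (x * y) = \pi_Q (c *: (x * y)) by rewrite quot_piZ.
by rewrite scalerAr quot_piM quot_piZ.
Qed.

HB.instance Definition _ := GRing.Lalgebra_isAlgebra.Build k Q quot_scaleAr.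

Definition quot_pi (a : A) : Q := \pi_Q a.

End AlgebraQuotient.

Arguments quot_pi {k A} I a.

(* The map induced by [f] on [A / I]; it does not depend on the choice of
   representatives as soon as [f] is additive and maps [I] into itself. *)
Definition quot_map (k : comNzRingType) (A : algType k) (I : idealType A)
  (f : A -> A) (x : alg_quot I) : alg_quot I := quot_pi I (f (repr x)).

Arguments quot_map {k A} I f x.

Definition k_involution (k : comNzRingType) (A : algType k) (i : A -> A) :
  Prop :=
  [/\ linear i, {morph i : x y / x * y >-> y * x} & involutive i].

Definition affine_algebra (k : comNzRingType) (B : comAlgType k) : Prop :=
  exists s : seq B, forall S : {pred B},
    subalg_closed S -> {subset s <= S} -> forall b, b \in S.

(* Fixing a basis v_1, ..., v_r of the free module V, we use coordinates:
   v_i (x) b in V (x)_k B is the column [b *: delta_mx i 0], b (x) v_j in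
   B (x)_k V is the row [b *: delta_mx 0 j], the flip between them is the
   transposition, and Delta (x)_B Delta' is the module of r x r matrices, the
   pure tensor u (x)_B w being the product [u *m w], so that
   v_i (x) b (x) v_j is [b *: delta_mx i j]. *)

Section CellBimodules.
Variables (k : comNzRingType) (A : algType k) (B : comAlgType k) (r : nat).

Record cell_bimodule (act : A -> 'cV[B]_r -> 'cV[B]_r) : Prop := {
  act1 : forall u, act 1 u = u;
  actM : forall a b u, act (a * b) u = act a (act b u);
  actDl : forall a b u, act (a + b) u = act a u + act b u;
  actDr : forall a u v, act a (u + v) = act a u + act a v;
  act_right : forall a b u, act a (b *: u) = b *: act a u;
  act_scalar : forall c a u, act (c *: a) u = c%:A *: act a u
}.

(* The right [A]-structure of Delta', twisted by the involution [i]. *)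
Definition dual_act (i : A -> A) (act : A -> 'cV[B]_r -> 'cV[B]_r)
  (w : 'rV[B]_r) (a : A) : 'rV[B]_r := (act (i a) w^T)^T.

End CellBimodules.

(* [cell_iso] is only relevant on [J].  The fields [cell_isoMl] and
   [cell_isoMr] express the compatibility with the left and right actions on
   pure tensors, which generate Delta (x)_B Delta' additively. *)
Record affine_cell_ideal (k : comNzRingType) (A : algType k) (i : A -> A)
    (J : set A) := AffineCellIdeal {
  cell_ring : comAlgType k;
  cell_rank : nat;
  cell_form : 'M[cell_ring]_cell_rank;
  cell_inv : cell_ring -> cell_ring;
  cell_act : A -> 'cV[cell_ring]_cell_rank -> 'cV[cell_ring]_cell_rank;
  cell_iso : A -> 'M[cell_ring]_cell_rank;
  cell_left_ideal : left_ideal J;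
  cell_right_ideal : right_ideal J;
  cell_stable : i @` J = J;
  cell_rank_gt0 : (0 < cell_rank)%N;
  cell_affine : affine_algebra cell_ring;
  cell_involution : k_involution cell_inv;
  cell_actP : cell_bimodule cell_act;
  cell_iso_bij : set_bij J setT cell_iso;
  cell_isoD : forall x y, J x -> J y ->
    cell_iso (x + y) = cell_iso x + cell_iso y;
  cell_isoMl : forall a x u w, J x -> cell_iso x = u *m w ->
    cell_iso (a * x) = cell_act a u *m w;
  cell_isoMr : forall a x u w, J x -> cell_iso x = u *m w ->
    cell_iso (x * a) = u *m dual_act i cell_act w a;
  cell_iso_inv : forall x, J x ->
    cell_iso (i x) = (map_mx cell_inv (cell_iso x))^T;
  cell_formP : forall x y, J x -> J y ->
    cell_iso (x * y) = cell_iso x *m cell_form *m cell_iso y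
}.

Section PartialSums.
Variables (V : zmodType) (n : nat) (L : 'I_n -> set V).

Definition partial_sum (p : nat) : set V :=
  [set a | exists x : 'I_n -> V,
     (forall l, L l (x l)) /\ a = \sum_(l < n | (l < p)%N) x l].

Definition direct_decomposition : Prop :=
  forall a, exists! x : {ffun 'I_n -> V},
    (forall l, L l (x l)) /\ a = \sum_l x l.

End PartialSums.

Definition submodule (k : comNzRingType) (V : lmodType k) (S : set V) : Prop :=
  S 0 /\ forall (c : k) x y, S x -> S y -> S (c *: x + y).

(* [layer j] is J'_j, and the ideal J_(j-1) is the sum of the layers of index
   < j.  J_n is the whole algebra by [layer_decomposition], and
   J_(j-1) is a proper ideal for j <= n because the section J_j / J_(j-1)
   is isomorphic to a nonzero matrix module. *)
Record affine_cellular (k : comNzRingType) (A : algType k) (i : A -> A) :=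
    AffineCellular {
  cell_length : nat;
  layer : 'I_cell_length.+1 -> set A;
  lower_ideal : 'I_cell_length.+1 -> idealType A;
  cell_algebra_involution : k_involution i;
  layer_submodule : forall j, submodule (layer j);
  layer_decomposition : direct_decomposition layer;
  layer_stable : forall j, i @` layer j = layer j;
  lower_idealE : forall j : 'I_cell_length.+1,
    [set a | a \in (lower_ideal j : {pred A})] = partial_sum layer j;
  section_cell : forall j : 'I_cell_length.+1,
    affine_cell_ideal (quot_map (lower_ideal j) i)
      (quot_pi (lower_ideal j) @` partial_sum layer j.+1)
}.

Arguments layer {k A i} a l.
Arguments lower_ideal {k A i} a l.
Arguments section_cell {k A i} a j.

Section CellData.
Variables (k : comNzRingType) (A : algType k) (i : A -> A).
Variable C : affine_cellular i.

Local Notation n := (cell_length C).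

(* A / J_(j-1) and its ideal J_j / J_(j-1). *)
Definition upper_quot (j : 'I_n.+1) : algType k := alg_quot (lower_ideal C j).

Definition cell_section (j : 'I_n.+1) : set (upper_quot j) :=
  quot_pi (lower_ideal C j) @` partial_sum (layer C) j.+1.
Arguments cell_section j _ : clear implicits.

Definition cell_base (j : 'I_n.+1) : comAlgType k :=
  cell_ring (section_cell C j).

Definition cell_size (j : 'I_n.+1) : nat := cell_rank (section_cell C j).

Definition cell_mx (j : 'I_n.+1) : 'M[cell_base j]_(cell_size j) :=
  cell_form (section_cell C j).

Definition section_iso (j : 'I_n.+1) :
  upper_quot j -> 'M[cell_base j]_(cell_size j) :=
  cell_iso (section_cell C j).
Arguments section_iso j _ : clear implicits.

Definition section_faithful (l : 'I_n.+1) : Prop :=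
  right_ann (cell_section l) = [set 0].

Definition first_faithful (m : 'I_n.+1) : Prop :=
  section_faithful m /\ forall l, section_faithful l -> (m <= l)%N.

(* The matrix of right multiplication by [a] on J_j / J_(j-1), read through
   [section_iso]; it exists and is unique when [\det (cell_mx j)] is regular. *)
Definition right_mul_mx (j : 'I_n.+1) (a : A) :
    'M[cell_base j]_(cell_size j) :=
  xget 0 [set M | forall x, cell_section j x ->
    section_iso j (x * quot_pi (lower_ideal C j) a) = section_iso j x *m M].

Definition upto (m : 'I_n.+1) (j : 'I_m.+1) : 'I_n.+1 :=
  widen_ord (ltn_ord m) j.

Definition matrix_product (m : 'I_n.+1) : Type :=
  forall j : 'I_m.+1, 'M[cell_base (upto j)]_(cell_size (upto j)).

Definition cell_embedding (m : 'I_n.+1) (a : A) : matrix_product m :=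
  fun j => right_mul_mx (upto j) a.

Definition scalar_matrices (m : 'I_n.+1) : set (matrix_product m) :=
  [set M | forall j, exists b, M j = b%:M].

End CellData.

Arguments cell_base {k A i} C j.
Arguments cell_size {k A i} C j.
Arguments cell_mx {k A i} C j.
Arguments first_faithful {k A i} C m.
Arguments cell_section {k A i} C j _.
Arguments section_iso {k A i} C j _.
Arguments section_faithful {k A i} C l.
Arguments right_mul_mx {k A i} C j a.
Arguments cell_embedding {k A i} C m a.
Arguments scalar_matrices {k A i} C m.

(* Main.v *)
Require Import Defs.
From HB Require Import structures.
From mathcomp Require Import all_boot all_order all_algebra.
From mathcomp Require Import boolp classical_sets functions.

Set Implicit Arguments.
Unset Strict Implicit.
Unset Printing Implicit Defensive.

Import GRing.Theory.

Local Open Scope ring_scope.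
Local Open Scope quotient_scope.
Local Open Scope classical_set_scope.

(** Write J_{<p} for the ideal spanned by the layers of index < p, and Phi_j(a)
    for the matrix of right multiplication by a on the j-th section, which is
    a copy of M_r(B_j) with product X psi_j Y.

    The centre.  If a is central, right multiplication by a on a section is
    also left multiplication by a.  Both are given by matrices, so there are M
    and L with X M = L X for all X; hence M = L commutes with everything and is
    scalar ([cell_iso_center]).  Conversely, a with scalar Phi_j(a) for j <= m
    is central because the Phi_j, j <= m, are ring homomorphisms that are
    jointly injective ([embedding_faithful]): a common zero lies in J_{<m} by
    faithfulness of the m-th section, and an element of J_{<j+1} with matrix Y
    in the j-th section has Phi_j = psi_j Y, which determines Y because
    det psi_j is regular, so that such a zero descends through the chain to 0.

    From A to its centre Z.  This is the theorem of Eakin and Nagata in the form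
    of Formanek ([formanek]): a finitely generated module M over a commutative
    ring is Noetherian as soon as its submodules of the form IM satisfy the
    ascending chain condition.  For M = A over Z the sets IA are left ideals
    of A, so A is a Noetherian Z-module, and so is its submodule Z.

    From Z to A.  Filter A by the kernels A_j of (Phi_l)_{l < j}; A_{m+1} = 0.
    It suffices to embed A_j / A_{j+1} into a finite power of Z.  Given a in A_j
    and indices s, t, the elements u a v with u, v in J_{<j+1} have all Phi_l
    equal to 0 except for l = j, and a suitable sum of them has
        Phi_j = (Phi_j(a) psi_j)_{st} det psi_j   (a scalar matrix),
    hence is central ([central_entry]).  The r^2 central elements obtained in
    this way depend Z-linearly on a, and they vanish simultaneously only if
    Phi_j(a) psi_j = 0, that is, if a lies in A_{j+1}.  So A is a Noetherian
    Z-module, and one-sided ideals of A are Z-submodules. *)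

(** * Finite generation of submodules *)

Section Submodules.
Variables (R : comNzRingType) (V : lmodType R).
Implicit Types (S P Q : set V) (xs : seq V).

Lemma submodule0 S : submodule S -> S 0.
Proof. by case. Qed.

Lemma submoduleD S x y : submodule S -> S x -> S y -> S (x + y).
Proof. by case=> _ h Sx Sy; rewrite -[x]scale1r; exact: h. Qed.

Lemma submoduleZ S c x : submodule S -> S x -> S (c *: x).
Proof. by case=> S0 h Sx; rewrite -[_ *: _]addr0; exact: h. Qed.

Lemma submoduleB S x y : submodule S -> S x -> S y -> S (x - y).
Proof.
by move=> sS Sx Sy; rewrite -scaleN1r; apply: submoduleD (submoduleZ _ _ _).
Qed.

Lemma submodule_set0 : submodule [set (0 : V)].
Proof. by split=> // c x y /= -> ->; rewrite scaler0 addr0. Qed.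

Lemma submoduleI S P : submodule S -> submodule P -> submodule (S `&` P).
Proof.
move=> [S0 Sl] [P0 Pl]; split=> // c x y [Sx Px] [Sy Py].
by split; [apply: Sl|apply: Pl].
Qed.

(** The submodule generated by P and xs, as the intersection of the submodules
    containing them: no coefficients occur in the finiteness arguments below. *)
Definition generated P xs : set V :=
  [set v | forall S, submodule S -> P `<=` S -> [set` xs] `<=` S -> S v].

Lemma generated_submodule P xs : submodule (generated P xs).
Proof.
split=> [S [] //|c x y gx gy S sS PS xS].
by case: (sS) => _; apply; [exact: gx|exact: gy].
Qed.

Definition fg_over P S : Prop :=
  exists2 xs, [set` xs] `<=` S & S `<=` generated P xs.

(** For a submodule P this says that V / P is a Noetherian module; submodules
    containing P stand for those of the quotient. *)
Definition noetherian_above P : Prop :=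
  forall S, submodule S -> P `<=` S -> fg_over P S.

Lemma fg_over_sub P S : S `<=` P -> fg_over P S.
Proof. by move=> SP; exists [::] => // x /SP Px Q _ PQ _; exact: PQ. Qed.

Lemma fg_over_trans P Q S : Q `<=` S -> fg_over P Q -> fg_over Q S ->
  fg_over P S.
Proof.
move=> QS [xs xQ Qx] [ys yS Sy]; exists (xs ++ ys) => [x /=|s Ss U sU PU xyU].
  by rewrite mem_cat => /orP[/xQ/QS|/yS].
apply: Sy => // [q Qq|y yy]; last by apply: xyU; rewrite /= mem_cat yy orbT.
apply: Qx => // x xx; by apply: xyU; rewrite /= mem_cat xx.
Qed.

Lemma fg_over_subl P Q S : P `<=` Q -> fg_over P S -> fg_over Q S.
Proof.
move=> PQ [xs xS Sx]; exists xs => // s Ss U sU QU; apply: Sx => //.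
exact: subset_trans QU.
Qed.

Lemma noetherian_above_sub P Q : P `<=` Q -> noetherian_above P ->
  noetherian_above Q.
Proof.
move=> PQ nP S sS QS; apply: (fg_over_subl PQ).
by apply: nP => //; exact: subset_trans QS.
Qed.

Lemma fg_over_combinations S : submodule S -> fg_over [set 0] S ->
  exists (n : nat) (g : 'I_n -> V),
    S = [set v | exists c : 'I_n -> R, v = \sum_(t < n) c t *: g t].
Proof.
move=> sS [xs xS Sx]; exists (size xs), (fun t => nth 0 xs t).
apply/seteqP; split=> [s Ss|_ [c ->]]; last first.
  elim/big_rec: _ => [|t y _ Sy]; first exact: submodule0.
  by apply: (submoduleD sS) => //; apply: (submoduleZ _ sS); apply/xS/mem_nth.
apply: Sx => //.
- split=> [|d x y [c ->] [e ->]].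
    by exists (fun=> 0); rewrite big1 // => t _; rewrite scale0r.
  exists (fun t => d * c t + e t); rewrite scaler_sumr -big_split.
  by apply: eq_bigr => t _; rewrite scalerDl scalerA.
- by move=> _ ->; exists (fun=> 0); rewrite big1 // => t _; rewrite scale0r.
- move=> x /= xx; have lt_x : (index x xs < size xs)%N by rewrite index_mem.
  exists (fun t => (t == Ordinal lt_x)%:R).
  rewrite (bigD1 (Ordinal lt_x)) //= eqxx scale1r nth_index // big1 ?addr0 //.
  by move=> t /negPf ->; rewrite scale0r.
Qed.

Lemma combinations_fg_over P (n : nat) (g : 'I_n -> V) :
  fg_over P [set v | exists c : 'I_n -> R, v = \sum_(t < n) c t *: g t].
Proof.
exists [seq g t | t <- enum 'I_n] => [_ /mapP[t _ ->]|_ [c ->] S sS _ gS].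
  exists (fun u => (u == t)%:R).
  rewrite (bigD1 t) //= eqxx scale1r big1 ?addr0 // => u /negPf ->.
  by rewrite scale0r.
elim/big_rec: _ => [|t y _ Sy]; first exact: submodule0.
apply: (submoduleD sS) => //; apply: (submoduleZ _ sS); apply: gS.
by apply/mapP; exists t; rewrite ?mem_enum.
Qed.

Lemma chain_finite (c : set (set V)) xs : c !=set0 -> total_on c subset ->
  [set` xs] `<=` \bigcup_(N in c) N -> exists2 N, c N & [set` xs] `<=` N.
Proof.
move=> [N0 cN0] tot; elim: xs => [_|x xs IH xxs]; first by exists N0.
have [|N cN xN] := IH.
  by move=> y yy; apply: xxs; rewrite /= inE; apply/orP; right.
have [|U cU Ux] := xxs x; first by rewrite /= inE eqxx.
have [NU|UN] := tot _ _ cN cU.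
  by exists U => // y; rewrite /= inE => /orP[/eqP -> //|yy]; exact/NU/xN.
exists N => // y; rewrite /= inE => /orP[/eqP ->|yy]; [exact: UN|exact: xN].
Qed.

Lemma chain_submodule (c : set (set V)) : c !=set0 -> total_on c subset ->
  (forall N, c N -> submodule N) -> submodule (\bigcup_(N in c) N).
Proof.
move=> [N0 cN0] tot sc; split.
  by exists N0 => //; exact: (submodule0 (sc _ cN0)).
move=> a x y [S cS Sx] [N cN Ny]; have [SN|NS] := tot _ _ cS cN.
- by exists N => //; case: (sc _ cN) => _; apply=> //; exact: SN.
- by exists S => //; case: (sc _ cS) => _; apply=> //; exact: NS.
Qed.

End Submodules.

(** A relation instead of a map, because two kinds of partially determined maps
    are needed: the coefficient of a given generator in an expression of an
    element, and central elements that are only known to exist. *)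
Definition linear_relation (R : comNzRingType) (V W : lmodType R)
    (T : V -> W -> Prop) : Prop :=
  forall c s w s' w', T s w -> T s' w' -> T (c *: s + s') (c *: w + w').

Section Relations.
Variables (R : comNzRingType) (V W : lmodType R) (P : set W).
Hypotheses (sP : submodule P) (nP : noetherian_above P).

(** The extension principle for Noetherian modules.  The image of S under T is
    finitely generated modulo P; lift its generators to S.  If a submodule S'
    contains the lifts and the part of S related to P, then the image of S' is
    everything, so that each s in S differs from an element of S' by an element
    related to P. *)
Lemma fg_over_relation (S : set V) (T : V -> W -> Prop) :
  submodule S -> linear_relation T -> T 0 0 ->
  (forall s, S s -> exists w, T s w) ->
  fg_over [set s | S s /\ exists2 w, P w & T s w] S.
Proof.
move=> sS lT T0 totT.
pose U (S' : set V) := [set w | exists s, exists2 p, S' s & P p /\ T s (w + p)].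
have sU S' : submodule S' -> submodule (U S').
  move=> [S0 Sl]; split; first by exists 0, 0 => //; rewrite addr0; case: sP.
  move=> c w w' [s [p Ss [Pp Tsp]]] [s' [p' Ss' [Pp' Tsp']]].
  exists (c *: s + s'), (c *: p + p'); first exact: Sl.
  split; first by case: sP => _; apply.
  by rewrite addrACA -scalerDr; exact: lT.
have PU S' : submodule S' -> P `<=` U S'.
  move=> [S0 _] p Pp; exists 0, (- p) => //; rewrite subrr; split=> //.
  by rewrite -[- p]add0r; apply: submoduleB => //; exact: submodule0.
have [ws wU Uw] := nP (sU _ sS) (PU _ sS).
have /choice[l lP] : forall w, exists s,
    U S w -> S s /\ exists2 p, P p & T s (w + p).
  move=> w; have [[s [p Ss [Pp Tsp]]]|nU] := pselect (U S w).
    by exists s => _; split => //; exists p.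
  by exists 0.
exists [seq l w | w <- ws].
  by move=> _ /mapP[w /wU/lP[Slw _] ->].
move=> s Ss S' sS' kS' lS'.
have [w Tsw] := totT s Ss.
have sSS' := submoduleI sS sS'.
have [s' [p [Ss' S's'] [Pp Ts']]] : U (S `&` S') w.
  apply: (Uw w _ _ (sU _ sSS') (PU _ sSS')) => [|v vv].
    by exists s, 0 => //; rewrite addr0; case: sP.
  have [Sv [p Pp Tv]] := lP _ (wU _ vv).
  by exists (l v), p => //; split=> //; apply: lS'; apply: map_f.
have -> : s = (s - s') + s' by rewrite subrK.
apply: submoduleD => //; apply: kS'; split; first exact: submoduleB.
exists (- p); first by rewrite -[- p]add0r; apply: submoduleB (submodule0 _) _.
have := lT (-1) _ _ _ _ Ts' Tsw.
by rewrite !scaleN1r [- s' + s]addrC opprD addrAC addNr add0r.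
Qed.

(** If finitely many linear relations into a Noetherian module jointly separate
    the elements of S, then S is finitely generated: this is the embedding of S
    into a finite power of W / P, one coordinate at a time. *)
Lemma fg_over_relations (I : eqType) (T : I -> V -> W -> Prop) (l : seq I)
    (S : set V) :
  submodule S -> (forall i, linear_relation (T i)) -> (forall i, T i 0 0) ->
  (forall i s, S s -> exists w, T i s w) ->
  fg_over [set s | S s /\ forall i, i \in l -> exists2 w, P w & T i s w] S.
Proof.
move=> sS lT T0; elim: l S sS => [|i l IH] S sS totT; first exact: fg_over_sub.
set Q := [set s | S s /\ exists2 w, P w & T i s w].
have sQ : submodule Q.
  split; first by split; [exact: submodule0|exists 0 => //; exact: submodule0].
  move=> c x y [Sx [v Pv Tv]] [Sy [w Pw Tw]].
  split; first by case: sS => _; apply.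
  by exists (c *: v + w); [case: sP => _; apply|exact: lT].
have QS : Q `<=` S by move=> s [].
apply: (fg_over_trans QS); last by apply: fg_over_relation => //; exact: totT.
have [xs xQ Qx] := IH Q sQ (fun j s Qs => totT j s (QS s Qs)).
exists xs => // s /Qx gs U sU kU; apply: gs => // t [[St Tit] Tlt].
apply: kU; split=> // j; rewrite inE => /orP[/eqP -> //|]; exact: Tlt.
Qed.

End Relations.

Lemma chain_union_maximal (T : Type) (F : set (set T)) : F !=set0 ->
  (forall c, c `<=` F -> c !=set0 -> total_on c subset ->
     exists2 X, F X & \bigcup_(Y in c) Y `<=` X) ->
  exists2 X, F X & forall Y, F Y -> X `<=` Y -> Y `<=` X.
Proof.
move=> [X0 FX0] bound.
have [||c totc|[X FX] maxX] := @ZL_preorder {X | F X} (exist _ X0 FX0)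
  (fun X Y => `[< sval X `<=` sval Y >]).
- by move=> X; apply/asboolP.
- move=> X Y U /asboolP XY /asboolP YU.
  by apply/asboolP; exact: subset_trans YU.
- have [->|/set0P[X cX]] := eqVneq c set0; first by exists (exist _ X0 FX0).
  have [_ [Y _ <-]||_ _ [Y cY <-] [Z cZ <-]|U FU cU] := bound (sval @` c).
  + exact: svalP.
  + by exists (sval X), X.
  + by have [/asboolP|/asboolP] := totc Y Z cY cZ; [left|right].
  exists (exist _ U FU) => Y cY; apply/asboolP => x Yx; apply: cU.
  by exists (sval Y) => //; exists Y.
exists X => // Y FY XY.
by apply/asboolP; apply: (maxX (exist _ Y FY)); apply/asboolP.
Qed.

(** * Formanek's theorem *)

Section Formanek.
Variables (R : comNzRingType) (M : lmodType R).
Implicit Types (N X Y : set M) (I : set R^o) (xs : seq M).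

(** The annihilator of M / N. *)
Definition colon N : set R^o := [set r | forall v, N (r *: v)].

(** The submodule IM, for the ideal I generated by a set. *)
Definition ideal_mul I : set M :=
  [set v | forall N, submodule N -> I `<=` colon N -> N v].

Lemma colon_submodule N : submodule N -> submodule (colon N).
Proof.
move=> sN; split=> [v|c x y Nx Ny v].
  by rewrite scale0r; exact: submodule0.
rewrite scalerDl -scalerA; apply: submoduleD => //; exact: submoduleZ.
Qed.

Lemma ideal_mul_submodule I : submodule (ideal_mul I).
Proof.
split=> [N [] //|c x y gx gy N sN IN].
by case: (sN) => _; apply; [exact: gx|exact: gy].
Qed.

Lemma colon_generated N xs : submodule N -> setT `<=` generated set0 xs ->
  forall r, (forall x, x \in xs -> N (r *: x)) -> colon N r.
Proof.
move=> sN Mxs r rxs v; apply: (Mxs v I [set v | N (r *: v)]) => //.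
split=> [|c x y Nx Ny] /=; first by rewrite scaler0; exact: submodule0.
by rewrite scalerDr scalerA mulrC -scalerA; case: sN => _; apply.
Qed.

(** A nonzero submodule of M / N contains a nonzero cyclic submodule, and it is
    finitely generated modulo the latter if the proper quotients of M / N are
    Noetherian. *)
Lemma noetherian_above_covers N : submodule N ->
  (forall X, submodule X -> N `<=` X -> ~ X `<=` N -> noetherian_above X) ->
  noetherian_above N.
Proof.
move=> sN cov S sS NS.
have [SN|/existsNP[x /not_implyP[Sx Nx]]] := pselect (S `<=` N).
  exact: fg_over_sub.
pose X := generated N [:: x].
have sX : submodule X by exact: generated_submodule.
have NX : N `<=` X by move=> y Ny U _ NU _; exact: NU.
have Xx : X x by move=> U _ _; apply; rewrite /= inE.
have XS : X `<=` S.
  by move=> y; apply=> // z; rewrite /= inE => /eqP ->.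
apply: (@fg_over_trans _ _ N X) => //; last first.
  by apply: cov => // /(_ x Xx).
by exists [:: x] => // z; rewrite /= inE => /eqP ->.
Qed.

(** R / ann(M / N) embeds into (M / N)^xs by r |-> (r x)_x. *)
Lemma noetherian_above_colon N xs : submodule N -> noetherian_above N ->
  setT `<=` generated set0 xs -> noetherian_above (colon N).
Proof.
move=> sN nN Mxs I sI NI.
have [x c r v r' v' -> ->|x|x r Ir|ys yI Iy] :=
    @fg_over_relations _ R^o M N sN nN M (fun x r v => v = r *: x) xs I sI.
- by rewrite scalerDl scalerA.
- by rewrite scale0r.
- by exists (r *: x).
exists ys => // r /Iy gr U sU NU yU; apply: gr => // s [Is sxs].
by apply: NU; apply: (colon_generated sN Mxs) => x /sxs[v Nv <-].
Qed.

(** A finitely generated module M / X over the Noetherian ring R / ann(M / X) is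
    Noetherian.  The relation T below sends s to the possible coefficients of x
    in an expression of s by x, xs and X. *)
Lemma noetherian_above_module X xs : submodule X ->
  noetherian_above (colon X) -> setT `<=` generated set0 xs ->
  noetherian_above X.
Proof.
move=> sX nX Mxs S sS _.
have : S `<=` generated X xs.
  by move=> s _ U sU _ xU; apply: (Mxs s I U) => // y [].
elim: xs S sS {Mxs} => [|x xs IH] S sS Sxs.
  by apply: fg_over_sub => s /Sxs; apply=> // y; rewrite /= inE.
pose G := generated X xs.
have sG : submodule G by exact: generated_submodule.
have XG : X `<=` G by move=> y Xy U _ XU _; exact: XU.
pose T (s : M) (r : R^o) := G (s - r *: x).
have lT : linear_relation T.
  move=> c s w s' w' Gs Gs'; rewrite /T scalerDl -scalerA opprD addrACA.
  by rewrite -scalerBr; case: sG => _; apply.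
apply: (@fg_over_trans _ _ _ (S `&` G)); first by move=> s [].
  by apply: IH => [|s []//]; exact: submoduleI.
have [|s Ss|ys yS Sy] :=
    fg_over_relation (colon_submodule sX) nX sS lT.
- by rewrite /T scale0r subrr; exact: submodule0.
- apply: (Sxs s Ss [set s | exists r, T s r]) => [|y Xy|y].
  + split=> [|c u v [r Tr] [t Tt]]; last by exists (c *: r + t); exact: lT.
    by exists 0; rewrite /T scale0r subrr; exact: submodule0.
  + by exists 0; rewrite /T scale0r subr0; exact: XG.
  + rewrite /= inE => /orP[/eqP ->|yy].
      by exists 1; rewrite /T scale1r subrr; exact: submodule0.
    by exists 0; rewrite /T scale0r subr0 => U _ _; exact.
exists ys => // s /Sy gs U sU kU yU; apply: gs => // t [St [r Xr Tr]].
apply: kU; split=> //; rewrite -[t](subrK (r *: x)).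
by apply: (submoduleD sG) => //; exact: XG.
Qed.

(** Zorn's lemma for the quotients M / N of M / X with the same annihilator:
    the union U of a chain is admissible because r M lies in U only if the
    finitely many r x, x in xs, do; these lie in one member, and then so does
    r M. *)
Lemma maximal_faithful X xs : submodule X -> setT `<=` generated set0 xs ->
  exists N, [/\ submodule N, X `<=` N, colon N `<=` colon X &
    forall Y, submodule Y -> N `<=` Y -> colon Y `<=` colon X -> Y `<=` N].
Proof.
move=> sX Mxs.
pose F N := [/\ submodule N, X `<=` N & colon N `<=` colon X].
have [||N [sN XN cN] maxN] := @chain_union_maximal _ F.
- by exists X; split.
- move=> c cF cn0 totc; exists (\bigcup_(N in c) N) => //.
  split; first by apply: chain_submodule => // N /cF[].
    case: cn0 => N cN x Xx; exists N => //.
    by case: (cF _ cN) => _ XN _; exact: XN.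
  move=> r rU.
  have [|N cN Nrx] := @chain_finite _ _ c [seq r *: x | x <- xs] cn0 totc.
    by move=> _ /mapP[x _ ->]; exact: rU.
  have [sN _ cN'] := cF _ cN; apply: cN'.
  by apply: (colon_generated sN Mxs) => x xx; apply: Nrx; exact: map_f.
exists N; split=> // Y sY NY cY.
by apply: maxN => //; split=> //; exact: subset_trans NY.
Qed.

(** Suppose that M is not Noetherian, and let X = IM be maximal such that M / X
    is not Noetherian.  Let N be maximal above X with the annihilator of M / N
    equal to that of M / X.  Any submodule Y properly containing N contains r M
    for some r not annihilating M / X, hence contains IM + rM, which is larger
    than X; so M / Y is Noetherian, and therefore M / N is.  Then so are the
    ring R / ann(M / N) = R / ann(M / X), and the finitely generated module
    M / X over it, a contradiction. *)
Theorem formanek xs : setT `<=` generated set0 xs ->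
  (forall F : set (set M), (exists X, F X) ->
     (forall X, F X -> exists I, X = ideal_mul I) ->
     exists2 X, F X & forall Y, F Y -> X `<=` Y -> Y `<=` X) ->
  noetherian_above [set (0 : M)].
Proof.
move=> Mxs maxF.
pose F X := (exists I, X = ideal_mul I) /\ ~ noetherian_above X.
suff nF : ~ exists X, F X.
  apply: (@noetherian_above_sub _ _ (ideal_mul set0)); last first.
    apply: contrapT => nn; apply: nF; exists (ideal_mul set0).
    by split=> //; exists set0.
  by move=> v; apply => //; exact: submodule_set0.
move=> exF; have [|_ [[I ->] nI] maxI] := maxF F exF; first by move=> X [].
set X := ideal_mul I in nI maxI.
have sX : submodule X by exact: ideal_mul_submodule.
have [N [sN XN cN maxN]] := maximal_faithful sX Mxs.
apply: nI; apply: (noetherian_above_module sX _ Mxs).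
apply: noetherian_above_sub cN _; apply: (noetherian_above_colon sN _ Mxs).
apply: noetherian_above_covers => // Y sY NY nYN.
have /existsNP[r /not_implyP[Yr nXr]] : ~ colon Y `<=` colon X.
  by move=> cY; apply: nYN; exact: maxN.
pose Z := ideal_mul (I `|` [set r]).
have XZ : X `<=` Z.
  by move=> v Xv U sU IU; apply: Xv => // s Is; apply: IU; left.
have ZY : Z `<=` Y.
  move=> v; apply=> // s [Is|->//] w.
  by apply/NY/XN => U sU; apply.
apply: (noetherian_above_sub ZY); apply: contrapT => nZ; apply: nXr => v.
apply: (maxI Z) => //; first by split=> //; exists (I `|` [set r]).
by move=> U sU; apply; right.
Qed.

End Formanek.

(** * Rings over their centres *)

Lemma left_noetherian_above (R : comNzRingType) :
  left_noetherian R -> noetherian_above [set (0 : R^o)].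
Proof.
move=> nR I sI _.
have [|n [g ->]] := nR I; last exact: (@combinations_fg_over _ R^o).
split=> [|x y|a x]; first exact: submodule0 sI.
  exact: (submoduleD sI).
exact: (@submoduleZ _ R^o).
Qed.

Lemma noetherian_above_noetherian (R : comNzRingType) :
  noetherian_above [set (0 : R^o)] -> noetherian R.
Proof.
move=> nR; have nl : left_noetherian R.
  move=> I [I0 ID IM]; have sI : submodule (I : set R^o).
    by split=> // c x y Ix Iy; apply: ID => //; exact: IM.
  by apply: (fg_over_combinations sI); apply: nR => // _ ->.
split=> // I [I0 ID IM].
have [|n [g Ig]] := nl I; first by split=> // a x Ix; rewrite mulrC; exact: IM.
exists n, g; rewrite {1}Ig; apply/seteqP.
by split=> _ [c ->]; exists c; apply: eq_bigr => t _; rewrite mulrC.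
Qed.

(** An alias, so that scaling by central elements does not compete with the
    other module structures that A may carry. *)
Definition center_module (A : nzRingType) : Type := A.

Section CenterModule.
Variable A : nzRingType.
Local Notation Z := (center_ring A).
Local Notation M := (center_module A).

HB.instance Definition _ := GRing.Zmodule.copy M A.

Definition center_scale (z : Z) (a : M) : M := val z * (a : A).

Fact center_scaleA z z' a :
  center_scale z (center_scale z' a) = center_scale (z * z') a.
Proof. by rewrite /center_scale rmorphM mulrA. Qed.

Fact center_scale1 : left_id 1 center_scale.
Proof. by move=> a; rewrite /center_scale rmorph1 mul1r. Qed.

Fact center_scaleDr : right_distributive center_scale +%R.
Proof. by move=> z a b; rewrite /center_scale mulrDr. Qed.

Fact center_scaleDl a : {morph center_scale^~ a : z z' / z + z'}.
Proof. by move=> z z'; rewrite /center_scale rmorphD mulrDl. Qed.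

HB.instance Definition _ := GRing.Zmodule_isLmodule.Build Z M
  center_scaleA center_scale1 center_scaleDr center_scaleDl.

Lemma center_scaleE (z : Z) (a : M) : z *: a = val z * (a : A) :> A.
Proof. by []. Qed.

Lemma center_valC (z : Z) (a : A) : val z * a = a * val z.
Proof. exact: (centerP _ (valP z)). Qed.

(** One-sided ideals are submodules over the centre, and generators over the
    centre are a fortiori generators as one-sided ideals. *)
Lemma noetherian_finite_over_center :
  noetherian_above [set (0 : M)] -> noetherian A /\ finite_over_center A.
Proof.
move=> nM.
have fgM (S : set M) : submodule S -> exists (n : nat) (g : 'I_n -> M),
    S = [set v | exists c : 'I_n -> Z, v = \sum_(t < n) c t *: g t].
  move=> sS; apply: fg_over_combinations => //; apply: nM => // _ ->.
  exact: submodule0.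
split; first split.
- move=> I [I0 ID IM]; have sI : submodule (I : set M).
    by split=> // z x y Ix Iy; apply: ID => //; exact: IM.
  have [n [g Ig]] := fgM I sI; exists n, g; apply/seteqP; split=> x.
    by rewrite Ig => -[c ->]; exists (fun t => val (c t)).
  move=> [c ->]; elim/big_rec: _ => [//|t y _ Iy]; apply: ID => //; apply: IM.
  rewrite Ig; exists (fun u => (u == t)%:R).
  rewrite (bigD1 t) //= eqxx scale1r big1 ?addr0 // => u /negPf ->.
  by rewrite scale0r.
- move=> I [I0 ID IM]; have sI : submodule (I : set M).
    split=> // z x y Ix Iy; apply: ID => //.
    by rewrite center_scaleE center_valC; exact: IM.
  have [n [g Ig]] := fgM I sI; exists n, g; apply/seteqP; split=> x.
    rewrite Ig => -[c ->]; exists (fun t => val (c t)).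
    by apply: eq_bigr => t _; rewrite -center_valC.
  move=> [c ->]; elim/big_rec: _ => [//|t y _ Iy]; apply: ID => //; apply: IM.
  rewrite Ig; exists (fun u => (u == t)%:R).
  rewrite (bigD1 t) //= eqxx scale1r big1 ?addr0 // => u /negPf ->.
  by rewrite scale0r.
- have [n [g Mg]] := fgM setT ltac:(by []); exists n, g => a.
  by have : [set: M] a by []; rewrite Mg.
Qed.

Lemma left_ideal_maximal (F : set (set A)) : left_noetherian A ->
  F !=set0 -> (forall X, F X -> left_ideal X) ->
  exists2 X, F X & forall Y, F Y -> X `<=` Y -> Y `<=` X.
Proof.
move=> nA exF lF; apply: chain_union_maximal => // c cF cn0 totc.
have lc X : c X -> left_ideal X by move=> /cF/lF.
have lU : left_ideal (\bigcup_(X in c) X).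
  split=> [|x y [X cX Xx] [Y cY Yy]|a x [X cX Xx]].
  - by case: cn0 => X cX; exists X => //; case: (lc _ cX).
  - have [XY|YX] := totc _ _ cX cY.
      by exists Y => //; case: (lc _ cY) => _ YD _; apply: YD => //; exact: XY.
    by exists X => //; case: (lc _ cX) => _ XD _; apply: XD => //; exact: YX.
  - by exists X => //; case: (lc _ cX) => _ _; apply.
have [n [g Ug]] := nA _ lU.
have [|X cX gX] := @chain_finite _ M c [seq g u | u <- enum 'I_n] cn0 totc.
  move=> _ /mapP[u _ ->]; rewrite Ug; exists (fun w => (w == u)%:R).
  rewrite (bigD1 u) //= eqxx mul1r big1 ?addr0 // => w /negPf ->.
  by rewrite mul0r.
exists X; first exact: cF.
rewrite Ug => _ [e ->]; have [X0 XD XM] := lc _ cX.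
elim/big_rec: _ => [//|u y _ Xy]; apply: XD => //; apply: XM; apply: gX.
by apply/mapP; exists u; rewrite ?mem_enum.
Qed.

(** The theorem of Eakin and Nagata: [formanek] applies because I A is a left
    ideal for every ideal I of the centre, and the centre embeds into A by
    its action on 1. *)
Theorem noetherian_center :
  left_noetherian A -> finite_over_center A -> noetherian (center_ring A).
Proof.
move=> nA [n [g Ag]].
have Mxs : [set: M] `<=` generated set0 [seq (g t : M) | t <- enum 'I_n].
  move=> a _ S sS _ gS; have [c ->] := Ag a.
  elim/big_rec: _ => [|t y _ Sy]; first exact: submodule0 sS.
  apply: (submoduleD sS) => //; apply: (submoduleZ _ sS); apply: gS.
  by apply/mapP; exists t; rewrite ?mem_enum.
have nM : noetherian_above [set (0 : M)].
  apply: (formanek Mxs) => F exF FI.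
  apply: left_ideal_maximal => // X /FI[I ->].
  have [s0 sl] := ideal_mul_submodule M I.
  split=> // [x y Ix Iy|a x Ix N sN IN].
    by have := sl 1 x y Ix Iy; rewrite scale1r.
  apply: (Ix [set v : M | N (a * v)]) => [|r Ir v /=].
    split=> [|z u v Nu Nv] /=; first by rewrite mulr0; exact: submodule0 sN.
    rewrite mulrDr center_scaleE mulrA -center_valC -mulrA.
    by case: sN => _; apply.
  by rewrite center_scaleE mulrA -center_valC -mulrA; exact: IN.
apply: noetherian_above_noetherian.
have nC := noetherian_above_colon (@submodule_set0 _ M) nM Mxs.
apply: noetherian_above_sub nC => z /(_ 1) /=.
by rewrite center_scaleE mulr1 => z0; exact: val_inj.
Qed.

End CenterModule.

(** * Matrices and cell ideals *)

Section Matrices.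
Variables (B : comNzRingType) (r : nat).
Implicit Types M N X Y P : 'M[B]_r.

Lemma linear_cV_mulmx (f : 'cV[B]_r -> 'cV[B]_r) :
  (forall u v, f (u + v) = f u + f v) -> (forall b u, f (b *: u) = b *: f u) ->
  exists P : 'M_r, forall u, f u = P *m u.
Proof.
move=> fD fZ; exists (\matrix_(p, q) f (delta_mx q 0) p 0) => u.
have f0 : f 0 = 0 by have := fZ 0 0; rewrite !scale0r.
rewrite {1}[u]matrix_sum_delta (big_morph _ fD f0).
apply/matrixP=> p o; rewrite ord1 summxE !mxE; apply: eq_bigr => q _.
by rewrite big_ord1 fZ !mxE mulrC.
Qed.

Lemma scalar_of_commutant M : (0 < r)%N ->
  (forall X, X *m M = M *m X) -> exists b, M = b%:M.
Proof.
case: r M => // r' M _ cM; exists (M 0 0); apply/matrixP=> p q.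
have := congr1 (fun X : 'M_r'.+1 => X 0 q) (cM (delta_mx 0 p)).
rewrite !mxE (bigD1 p) //= mxE !eqxx mul1r big1 ?addr0 => [->|s /negPf sp].
  rewrite (bigD1 0) //= big1 ?addr0 => [|s /negPf s0].
    by rewrite !mxE eqxx mulr_natr eq_sym.
  by rewrite mxE s0 mulr0.
by rewrite mxE sp andbF mul0r.
Qed.

Lemma mulmx_regular_eq0 P X :
  GRing.lreg (\det P) -> P *m X = 0 -> X = 0.
Proof.
move=> dP PX; apply/matrixP=> p q; apply: dP; rewrite mxE mulr0.
have := congr1 (fun Y : 'M_r => Y p q) (congr1 (mulmx (\adj P)) PX).
by rewrite /= mulmxA mul_adj_mx mul_scalar_mx mulmx0 !mxE.
Qed.

Lemma mulmx_regular_eq0r P X :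
  GRing.lreg (\det P) -> X *m P = 0 -> X = 0.
Proof.
move=> dP /(congr1 trmx); rewrite trmx_mul trmx0 => h.
apply: trmx_inj; rewrite trmx0; apply: mulmx_regular_eq0 h.
by rewrite det_tr.
Qed.

Lemma sum_delta_mulmx N (s t : 'I_r) :
  \sum_q delta_mx q s *m N *m delta_mx t q = (N s t)%:M :> 'M_r.
Proof.
apply/matrixP=> p q; rewrite summxE (bigD1 q) //= big1 => [|l /negPf lq].
  rewrite addr0 !mxE (bigD1 t) //= big1 => [|l /negPf lt].
    rewrite addr0 !mxE (bigD1 s) //= big1 => [|l /negPf ls].
      by rewrite addr0 !mxE !eqxx andbT mulr1 mulr_natl.
    by rewrite !mxE ls andbF mul0r.
  by rewrite !mxE lt /= mulr0.
by rewrite !mxE big1 // => o _; rewrite !mxE [q == l]eq_sym lq andbF mulr0.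
Qed.

End Matrices.

Section CellIdeal.
Variables (k : comNzRingType) (A : algType k) (i : A -> A) (J : set A).
Variable D : affine_cell_ideal i J.
Local Notation iso := (cell_iso D).
Local Notation r := (cell_rank D).
Local Notation B := (cell_ring D).

Lemma cell_iso_surj (Y : 'M[B]_r) : exists2 x, J x & iso x = Y.
Proof. by case: (cell_iso_bij D) => _ _ /(_ Y I). Qed.

Lemma cell_iso_inj x y : J x -> J y -> iso x = iso y -> x = y.
Proof. by case: (cell_iso_bij D) => _ inj _ Jx Jy; apply: inj; rewrite inE. Qed.

Lemma cell_iso0 : iso 0 = 0.
Proof.
have J0 : J 0 by case: (cell_left_ideal D).
by apply: (addrI (iso 0)); rewrite -(cell_isoD D J0 J0) !addr0.
Qed.

Lemma cell_mulr_mem x a : J x -> J (x * a).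
Proof. by case: (cell_right_ideal D) => _ _; apply. Qed.

Lemma cell_mull_mem x a : J x -> J (a * x).
Proof. by case: (cell_left_ideal D) => _ _; apply. Qed.

Lemma cell_iso_ind (P : 'M[B]_r -> Prop) :
  (forall (u : 'cV_r) (w : 'rV_r), P (u *m w)) ->
  (forall X Y, P X -> P Y -> P (X + Y)) ->
  forall X, P X.
Proof.
move=> Puw PD X.
have -> : X = \sum_q col q X *m delta_mx 0 q.
  apply/matrixP=> s t.
  rewrite summxE (bigD1 t) //= big1 ?addr0 => [|q /negPf qt].
    by rewrite !mxE big_ord1 !mxE !eqxx mulr1.
  by rewrite !mxE big_ord1 !mxE [t == q]eq_sym qt mulr0.
elim/big_rec: _ => [|q Y _ PY]; last exact: PD.
by rewrite -(mulmx0 _ (0 : 'cV_r)).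
Qed.

(** Additivity of [cell_iso] makes pure tensors sufficient to identify the
    transport of an additive endomorphism of J. *)
Lemma cell_iso_ext (f : A -> A) (g : 'M[B]_r -> 'M[B]_r) :
  {morph f : x y / x + y} -> {morph g : X Y / X + Y} ->
  (forall x, J x -> J (f x)) ->
  (forall x (u : 'cV_r) (w : 'rV_r), J x -> iso x = u *m w ->
     iso (f x) = g (u *m w)) ->
  forall x, J x -> iso (f x) = g (iso x).
Proof.
move=> fD gD Jf fg x Jx; move: {2 3}(iso x) (erefl (iso x)) => X.
elim/cell_iso_ind: X x Jx => [u w|X Y IHX IHY] x Jx isox; first exact: fg.
have [[y Jy isoy] [z Jz isoz]] := (cell_iso_surj X, cell_iso_surj Y).
have -> : x = y + z.
  apply: cell_iso_inj => //; last by rewrite cell_isoD // isoy isoz.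
  by case: (cell_left_ideal D) => _ h _; exact: h.
rewrite fD cell_isoD; [|exact: Jf..].
by rewrite (IHX y) // (IHY z) // gD.
Qed.

Lemma cell_iso_mulr a :
  exists M, forall x, J x -> iso (x * a) = iso x *m M.
Proof.
have [P actP] := linear_cV_mulmx (actDr (cell_actP D) (i a))
  (act_right (cell_actP D) (i a)).
exists P^T; apply: (@cell_iso_ext ( *%R^~ a) (mulmx^~ P^T)).
- by move=> x y; exact: mulrDl.
- by move=> X Y; exact: mulmxDl.
- by move=> x; exact: cell_mulr_mem.
move=> x u w Jx isox.
by rewrite (cell_isoMr a Jx isox) /dual_act actP trmx_mul trmxK mulmxA.
Qed.

Lemma cell_iso_mull a :
  exists L, forall x, J x -> iso (a * x) = L *m iso x.
Proof.
have [P actP] := linear_cV_mulmx (actDr (cell_actP D) a)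
  (act_right (cell_actP D) a).
exists P; apply: (@cell_iso_ext ( *%R a) (mulmx P)).
- by move=> x y; exact: mulrDr.
- by move=> X Y; exact: mulmxDr.
- by move=> x; exact: cell_mull_mem.
by move=> x u w Jx isox; rewrite (cell_isoMl a Jx isox) actP mulmxA.
Qed.

(** With L the matrix of left multiplication by a, X M = L X for all X; the case
    X = 1 gives M = L. *)
Lemma cell_iso_center a M : (forall x, J x -> a * x = x * a) ->
  (forall x, J x -> iso (x * a) = iso x *m M) -> exists b, M = b%:M.
Proof.
move=> aC aM; have [L aL] := cell_iso_mull a.
have LM X : X *m M = L *m X.
  by have [x Jx <-] := cell_iso_surj X; rewrite -aM // -aC // aL.
have ML : M = L by have := LM 1%:M; rewrite mul1mx mulmx1.
by apply: scalar_of_commutant (cell_rank_gt0 D) _ => X; rewrite LM ML.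
Qed.

End CellIdeal.

(** * The cell chain and its matrix representations *)

Section QuotientMap.
Variables (k : comNzRingType) (A : algType k) (I : idealType A).

Lemma quot_pi_eq0 a : (quot_pi I a = 0) <-> (a \in (I : {pred A})).
Proof.
rewrite -[a in a \in _]subr0 -alg_quotE.
by rewrite (@pi_zeror _ _ _ _ _ (Quotient.quot I)).
Qed.

Lemma quot_piDE a b : quot_pi I (a + b) = quot_pi I a + quot_pi I b.
Proof. exact: quot_piD. Qed.

Lemma quot_piME a b : quot_pi I (a * b) = quot_pi I a * quot_pi I b.
Proof. exact: quot_piM. Qed.

Lemma quot_pi_surj x : exists a, quot_pi I a = x.
Proof. by exists (repr x); rewrite /quot_pi reprK. Qed.

End QuotientMap.

Section Chain.
Variables (k : comNzRingType) (A : algType k) (i : A -> A).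
Variable C : affine_cellular i.
Local Notation n := (cell_length C).
Local Notation chain := (partial_sum (layer C)).

Lemma chain_lower (j : 'I_n.+1) a :
  chain j a <-> a \in (lower_ideal C j : {pred A}).
Proof. by rewrite -(lower_idealE j). Qed.

Lemma chain0 a : chain 0 a -> a = 0.
Proof. by case=> x [_ ->]; rewrite big_pred0. Qed.

Lemma chain_mono p q a : (p <= q)%N -> chain p a -> chain q a.
Proof.
move=> pq [x [Lx ->]].
exists (fun l : 'I_n.+1 => if (l < p)%N then x l else 0); split.
  by move=> l; case: ifP => // _; case: (layer_submodule l).
rewrite [RHS]big_mkcond [LHS]big_mkcond /=; apply: eq_bigr => l _.
case: (ltnP l p) => [lp|_]; first by rewrite (leq_trans lp pq).
by case: ifP.
Qed.

Local Notation Phi := (right_mul_mx C).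
Local Notation base j := (cell_base C j).

Lemma section_pi (j : 'I_n.+1) y :
  chain j.+1 y -> cell_section C j (quot_pi (lower_ideal C j) y).
Proof. by exists y. Qed.

Lemma right_mul_mxE (j : 'I_n.+1) a x : cell_section C j x ->
  section_iso C j (x * quot_pi (lower_ideal C j) a) =
  section_iso C j x *m Phi j a.
Proof.
move: x; rewrite /right_mul_mx; set S := [set M | _].
have [M MP] := cell_iso_mulr (section_cell C j) (quot_pi (lower_ideal C j) a).
by apply: (xgetPex 0 (ex_intro S M _)) => x; exact: MP.
Qed.

Lemma right_mul_mx_unique (j : 'I_n.+1) a M :
  (forall x, cell_section C j x ->
     section_iso C j (x * quot_pi (lower_ideal C j) a) =
     section_iso C j x *m M) -> Phi j a = M.
Proof.
move=> aM; have [x Jx x1] := cell_iso_surj (D := section_cell C j) 1%:M.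
by have := right_mul_mxE a Jx; rewrite aM // /section_iso x1 !mul1mx.
Qed.

Lemma right_mul_mxD (j : 'I_n.+1) a b : Phi j (a + b) = Phi j a + Phi j b.
Proof.
apply: right_mul_mx_unique => x Jx; rewrite quot_piDE mulrDr mulmxDr.
rewrite /section_iso (cell_isoD (section_cell C j)) => //; last 2 first.
- exact: (cell_mulr_mem (section_cell C j)).
- exact: (cell_mulr_mem (section_cell C j)).
by congr (_ + _); exact: right_mul_mxE.
Qed.

Lemma right_mul_mxM (j : 'I_n.+1) a b : Phi j (a * b) = Phi j a *m Phi j b.
Proof.
apply: right_mul_mx_unique => x Jx; rewrite quot_piME mulrA mulmxA.
rewrite right_mul_mxE ?right_mul_mxE //.
exact: (cell_mulr_mem (section_cell C j)).
Qed.

Lemma right_mul_mx_chain (j : 'I_n.+1) p a :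
  (p <= j)%N -> chain p a -> Phi j a = 0.
Proof.
move=> pj /(chain_mono pj)/chain_lower/quot_pi_eq0 a0.
apply: right_mul_mx_unique => x Jx; rewrite a0 mulr0 mulmx0.
exact: (cell_iso0 (section_cell C j)).
Qed.

Lemma right_mul_mx0 (j : 'I_n.+1) : Phi j 0 = 0.
Proof.
apply: (@right_mul_mx_chain _ j) => //.
by apply/chain_lower; rewrite rpred0.
Qed.

Lemma right_mul_mxB (j : 'I_n.+1) a b : Phi j (a - b) = Phi j a - Phi j b.
Proof. by apply: (addIr (Phi j b)); rewrite -right_mul_mxD !subrK. Qed.

Lemma right_mul_mx_section (j : 'I_n.+1) y : chain j.+1 y ->
  Phi j y = cell_mx C j *m section_iso C j (quot_pi (lower_ideal C j) y).
Proof.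
move=> Jy; apply: right_mul_mx_unique => x Jx.
by rewrite mulmxA; apply: (cell_formP _ Jx); exact: section_pi.
Qed.

Lemma section_lift (j : 'I_n.+1) (Y : 'M[base j]_(cell_size C j)) :
  exists2 y, chain j.+1 y & Phi j y = cell_mx C j *m Y.
Proof.
have [_ [y Jy <-] yY] := cell_iso_surj (D := section_cell C j) Y.
by exists y; rewrite // right_mul_mx_section // /section_iso yY.
Qed.

Lemma right_mul_mx_center (j : 'I_n.+1) a :
  a \in center A -> exists b, Phi j a = b%:M.
Proof.
move=> /centerP aC.
apply: (cell_iso_center (D := section_cell C j)
  (a := quot_pi (lower_ideal C j) a)).
  by move=> x _; have [y <-] := quot_pi_surj x; rewrite -!quot_piME aC.
exact: right_mul_mxE.
Qed.

Hypothesis det_regular : forall j, GRing.lreg (\det (cell_mx C j)).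

(** On the top section where a does not vanish, right multiplication by a is
    X |-> X psi Y with Y the matrix of a, and psi Y = 0 forces Y = 0. *)
Lemma chain_faithful p a : (p <= n.+1)%N -> chain p a ->
  (forall j : 'I_n.+1, (j < p)%N -> Phi j a = 0) -> a = 0.
Proof.
elim: p => [_ /chain0 //|p IH pn Jpa a0]; apply: IH; first exact: ltnW.
  have Phi0 := a0 (Ordinal pn) (ltnSn p).
  apply/(chain_lower (Ordinal pn))/quot_pi_eq0.
  move: Phi0; rewrite right_mul_mx_section //.
  move=> /(mulmx_regular_eq0 (@det_regular _)) iso0.
  have Jpi := @section_pi (Ordinal pn) _ Jpa.
  apply: (cell_iso_inj (D := section_cell C (Ordinal pn))) => //.
    by case: (cell_left_ideal (section_cell C (Ordinal pn))).
  by rewrite cell_iso0.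
by move=> j jp; apply: a0; exact: ltnW.
Qed.

Variable m : 'I_n.+1.
Hypothesis m_faithful : section_faithful C m.

Lemma embedding_faithful a :
  (forall j : 'I_n.+1, (j <= m)%N -> Phi j a = 0) -> a = 0.
Proof.
move=> a0; apply: (@chain_faithful m a); first exact: ltnW.
  apply/chain_lower/quot_pi_eq0.
  suff : right_ann (cell_section C m) (quot_pi (lower_ideal C m) a).
    by rewrite m_faithful.
  move=> x Jx; apply: (cell_iso_inj (D := section_cell C m)).
  - exact: (cell_mulr_mem (section_cell C m)).
  - by case: (cell_left_ideal (section_cell C m)).
  by rewrite cell_iso0 [LHS]right_mul_mxE // a0 // mulmx0.
by move=> j /ltnW; exact: a0.
Qed.

Lemma center_scalar a :
  a \in center A <->
  forall j : 'I_n.+1, (j <= m)%N -> exists b, Phi j a = b%:M.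
Proof.
split=> [aC j _|asc]; first exact: right_mul_mx_center.
apply/centerP => b; apply/subr0_eq/embedding_faithful => j /asc[c ac].
by rewrite right_mul_mxB !right_mul_mxM ac scalar_mxC subrr.
Qed.

Lemma center_embedding :
  [set a : A | a \in center A] = cell_embedding C m @^-1` scalar_matrices C m.
Proof.
apply/seteqP; split=> a /=.
  by move=> /center_scalar aC j; apply: aC; exact: ltn_ord j.
move=> asc; apply/center_scalar => j jm.
have <- : upto (Ordinal (jm : (j < m.+1)%N)) = j by exact: val_inj.
exact: asc.
Qed.

(** Let N = Phi_j(a) psi_j.  Summing over q the products of E_{qs}, N and E_{tq}
    gives N_{st} 1, so z is a sum of products u a v with u and v lifting
    adj(psi_j) E_{qs} and E_{tq}.  The factor a kills Phi_l(z) for l < j, and u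
    kills it for l > j. *)
Lemma central_entry (j : 'I_n.+1) a s t :
  (forall l : 'I_n.+1, (l < j)%N -> Phi l a = 0) ->
  exists z : center_ring A,
    Phi j (val z) = ((Phi j a *m cell_mx C j) s t * \det (cell_mx C j))%:M /\
    forall l : 'I_n.+1, l != j -> Phi l (val z) = 0.
Proof.
move=> a0; pose psi := cell_mx C j.
have /choice[u uP] q : exists y, chain j.+1 y /\
    Phi j y = psi *m (\adj psi *m delta_mx q s).
  by have [y] := section_lift (\adj psi *m delta_mx q s); exists y.
have /choice[v vP] q : exists y, chain j.+1 y /\ Phi j y = psi *m delta_mx t q.
  by have [y] := section_lift (delta_mx t q); exists y.
pose z := \sum_q u q * a * v q.
have Phiz l : Phi l z = \sum_q Phi l (u q) *m Phi l a *m Phi l (v q).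
  rewrite (big_morph _ (@right_mul_mxD l) (right_mul_mx0 l)).
  by apply: eq_bigr => q _; rewrite !right_mul_mxM.
have zj : Phi j z = ((Phi j a *m psi) s t * \det psi)%:M.
  rewrite mulrC -scale_scalar_mx -sum_delta_mulmx scaler_sumr Phiz.
  apply: eq_bigr => q _; rewrite (uP q).2 (vP q).2.
  by rewrite !mulmxA mul_mx_adj mul_scalar_mx -!scalemxAl.
have z0 l : l != j -> Phi l z = 0.
  move=> lj; rewrite Phiz big1 // => q _.
  have [lj'|jl|/val_inj/eqP] := ltngtP l j; last by rewrite (negPf lj).
    by rewrite a0 // mulmx0 mul0mx.
  by rewrite (right_mul_mx_chain jl (uP q).1) !mul0mx.
have zC : z \in center A.
  apply/center_scalar => l _; have [->|/z0 ->] := eqVneq l j.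
    by exists ((Phi j a *m psi) s t * \det psi).
  by exists 0; rewrite raddf0.
by exists (CenterRing zC).
Qed.

Definition kernel_below (p : nat) : set (center_module A) :=
  [set a | forall l : 'I_n.+1, (l < p)%N -> Phi l a = 0].

Lemma kernel_below_submodule p : submodule (kernel_below p).
Proof.
split=> [l _|z a b a0 b0 l lp]; first exact: right_mul_mx0.
by rewrite center_scaleE right_mul_mxD right_mul_mxM a0 // b0 // mulmx0 addr0.
Qed.

(** The elements provided by [central_entry], for all pairs st, embed
    A_j / A_{j+1} into a finite power of the centre. *)
Lemma fg_over_next_kernel (j : 'I_n.+1) (S : set (center_module A)) :
  noetherian_above [set (0 : (center_ring A)^o)] -> submodule S ->
  S `<=` kernel_below j -> fg_over (S `&` kernel_below j.+1) S.
Proof.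
move=> nZ sS Sj; pose psi := cell_mx C j.
pose T (st : 'I_(cell_size C j) * 'I_(cell_size C j)) (a : center_module A)
    (z : (center_ring A)^o) :=
  Phi j (val (z : center_ring A)) =
    ((Phi j a *m psi) st.1 st.2 * \det psi)%:M /\
  forall l : 'I_n.+1, l != j -> Phi l (val (z : center_ring A)) = 0.
have lT st : linear_relation (T st).
  move=> c a z a' z' [zj z0] [zj' z0'].
  have E l : Phi l (val (c * z + z' : center_ring A)) =
      Phi l (val c) *m Phi l (val (z : center_ring A)) +
      Phi l (val (z' : center_ring A)).
    by rewrite rmorphD rmorphM right_mul_mxD right_mul_mxM.
  split=> [|l lj]; last by rewrite E z0 // z0' // mulmx0 addr0.
  rewrite E zj zj' center_scaleE right_mul_mxD right_mul_mxM.
  have [b ->] := right_mul_mx_center j (valP c).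
  rewrite -scalar_mxM -raddfD /= !mul_scalar_mx mulmxDl -scalemxAl !mxE.
  by rewrite mulrDl mulrA.
have T0 st : T st 0 0.
  by split=> [|l _]; rewrite !right_mul_mx0 ?mul0mx ?mxE ?mul0r ?raddf0.
have := fg_over_relations (@submodule_set0 _ _) nZ
  (enum {: 'I_(cell_size C j) * 'I_(cell_size C j)}) sS lT T0.
have totT st s : S s -> exists z, T st s z.
  by move=> /Sj; exact: central_entry.
move=> /(_ totT); apply: fg_over_subl => s [Ss s0]; split=> // l.
rewrite ltnS leq_eqVlt => /orP[/eqP/val_inj ->|]; last exact: Sj.
apply: (mulmx_regular_eq0r (@det_regular j)); apply/matrixP=> x y.
have [|z -> [/esym + _]] := s0 (x, y); first by rewrite mem_enum.
rewrite right_mul_mx0 => /matrixP/(_ x x); rewrite !mxE eqxx mulr1n => h.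
by apply: (@det_regular j); rewrite mulr0 mulrC.
Qed.

Lemma noetherian_center_module : noetherian (center_ring A) ->
  noetherian_above [set (0 : center_module A)].
Proof.
move=> [/left_noetherian_above nZ _] S sS _.
have fgS q : (q <= m.+1)%N -> forall S : set (center_module A), submodule S ->
    S `<=` kernel_below (m.+1 - q) -> fg_over [set 0] S.
  elim: q => [_|q IH qm] {sS}S sS Sker.
    apply: fg_over_sub => s /Sker; rewrite subn0 => s0.
    by apply: embedding_faithful => j jm; exact: s0.
  have pn : (m.+1 - q.+1 < n.+1)%N
    by rewrite subSS (leq_ltn_trans (leq_subr _ _)).
  have sS1 := submoduleI sS (kernel_below_submodule (m.+1 - q)).
  apply: (fg_over_trans (@subIsetl _ S (kernel_below (m.+1 - q)))).
    by apply: IH (ltnW qm) _ sS1 (@subIsetr _ _ _).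
  have := @fg_over_next_kernel (Ordinal pn) S nZ sS Sker.
  by rewrite /= subSS -subSn.
by apply: (fgS m.+1) => // s _ l; rewrite subnn.
Qed.

End Chain.

Theorem corollary5p6 (k : comNzRingType) (k_noetherian : noetherian k)
  (A : algType k) (i : A -> A) (C : affine_cellular i)
  (base_reduced : forall j, reduced (cell_base C j))
  (det_regular : forall j, GRing.lreg (\det (cell_mx C j)))
  (m : 'I_(cell_length C).+1) (m_min : first_faithful C m) :
  [set a : A | a \in center A] =
    (cell_embedding C m) @^-1` (scalar_matrices C m) /\
  (noetherian A /\ finite_over_center A <-> noetherian (center_ring A)).
Proof.
have m_faithful : section_faithful C m by case: m_min.
split; first exact: center_embedding.
split=> [[[nA _] fA]|nZ]; first exact: noetherian_center.
apply: noetherian_finite_over_center.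
exact: (noetherian_center_module det_regular m_faithful nZ).
Qed.
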